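(* Let $d\in\mathbb{N}$ and consider a diffusion coefficient of the form $a=e_{\bm 0}+e_{\bm{\nu}^*}F_{\bm{\nu}^*}$ on $\mathbb{T}^d$, for some $\bm{\nu}^*\in\mathbb{Z}^d$ and with $e_{\bm 0},e_{\bm{\nu}^*}\in\mathbb{C}$ such that $$\alpha:=|e_{\bm{\nu}^*}|\,(2\|\bm{\nu}^*\|_2+3)<|e_{\bm 0}|.$$ Then, for any $\Lambda\subset\mathbb{Z}^d$ with $\bm 0\notin\Lambda$, the system $\{\Phi_{\bm{\nu}}\}_{\bm{\nu}\in\Lambda}$, $\Phi_{\bm{\nu}}=-\nabla\cdot(a\nabla\Psi_{\bm{\nu}})$, is a bounded Riesz system with constants $$b_\Phi=|e_{\bm 0}|^2-|e_{\bm 0}|\alpha>0,\qquad B_\Phi=\Big(|e_{\bm 0}|+\frac{\alpha}{2}\Big)^2,\qquad K_\Phi=|e_{\bm 0}|+\frac{\alpha}{2}.$$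
   Context: $\mathbb{T}^d=(\mathbb{R}/\mathbb{Z})^d$; functions are complex-valued. $F_{\bm{\nu}}(\bm{x})=\exp(2\pi\mathrm{i}\,\bm{\nu}\cdot\bm{x})$ for $\bm{\nu}\in\mathbb{Z}^d$, and $\Psi_{\bm{\nu}}=\frac{1}{4\pi^2\|\bm{\nu}\|_2^2}F_{\bm{\nu}}$ for $\bm{\nu}\in\mathbb{Z}^d\setminus\{\bm 0\}$. Bounded Riesz system: a family $\{\Phi_{\bm{\nu}}\}_{\bm{\nu}\in\Lambda}\subset L^2(\mathbb{T}^d)$ ($\Lambda\subset\mathbb{Z}^d$ countable) is a Riesz system with constants $0<b_\Phi\le B_\Phi<\infty$ if $$b_\Phi\|\bm{z}\|_2^2\le\Big\|\sum_{\bm{\nu}\in\Lambda}z_{\bm{\nu}}\Phi_{\bm{\nu}}\Big\|_{L^2}^2\le B_\Phi\|\bm{z}\|_2^2\qquad\forall\,\bm{z}\in\ell^2(\Lambda;\mathbb{C}),$$ and it is bounded with constant $0<K_\Phi<\infty$ if $\|\Phi_{\bm{\nu}}\|_{L^\infty}\le K_\Phi$ for all $\bm{\nu}\in\Lambda$. *)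

(* Defs.v *)
From HB Require Import structures.
From mathcomp Require Import all_boot all_order all_algebra.
From mathcomp Require Import all_classical all_reals all_analysis.
From mathcomp Require Import complex.

Set Implicit Arguments.
Unset Strict Implicit.
Unset Printing Implicit Defensive.

Import Order.TTheory GRing.Theory Num.Theory.
Import numFieldNormedType.Exports.

Local Open Scope classical_set_scope.
Local Open Scope ring_scope.
Local Open Scope complex_scope.

(* A function on the torus (R/Z)^d is represented by a
   Z^d-periodic function on R^d; points of R^d are tuples of reals with the
   product Borel sigma-algebra, frequencies in Z^d are integer row vectors. *)
Notation Rspace R d := (d.-tuple (measurableTypeR R)) (only parsing).

Definition tuple_cons (R : realType) d (p : measurableTypeR R * Rspace R d) :
  Rspace R d.+1 := [tuple of p.1 :: p.2].

Lemma measurable_tuple_cons (R : realType) d :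
  measurable_fun [set: measurableTypeR R * Rspace R d] (@tuple_cons R d).
Proof. exact: measurable_cons. Qed.

HB.instance Definition _ (R : realType) d :=
  @isMeasurableFun.Build _ _ _ _ (@tuple_cons R d) (@measurable_tuple_cons R d).

(* Lebesgue measure on the fundamental domain [0, 1]^d, as the d-fold product
   of the uniform probability on [0, 1]. *)
Fixpoint torus_measure (R : realType) (d : nat) : probability (Rspace R d) R :=
  match d with
  | 0 => \d_([tuple] : Rspace R 0)
  | d'.+1 => distribution
      (uniform_prob (@ltr01 R) \x torus_measure R d')%E (@tuple_cons R d')
  end.

Section torus_functions.
Variables (R : realType) (d : nat).
Local Notation C := R[i].
Local Notation Rd := (Rspace R d).
Local Notation Zd := 'rV[int]_d.
Implicit Types (f u : Rd -> C) (x : Rd) (nu k : Zd).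

Definition shift_int x k : Rd := [tuple tnth x i + (k 0 i)%:~R | i < d].

Definition periodic f := forall x k, f (shift_int x k) = f x.

Definition measurable_cfun f :=
  measurable_fun [set: Rd] (fun x => complex.Re (f x) : R) /\
  measurable_fun [set: Rd] (fun x => complex.Im (f x) : R).

Definition cLnorm (p : \bar R) f : \bar R :=
  Lnorm (torus_measure R d) p (fun x => (Normc.normc (f x))%:E).

Definition L2 f :=
  [/\ periodic f, measurable_cfun f & (cLnorm 2%:E f < +oo)%E].

Definition expi (t : R) : C := cos t +i* sin t.

Definition norm2 nu : R := Num.sqrt (\sum_(i < d) (nu 0 i)%:~R ^+ 2).

Definition fourier nu x : C :=
  expi (2 * pi * \sum_(i < d) (nu 0 i)%:~R * tnth x i).

Definition Psi nu x : C := ((4 * pi ^+ 2 * norm2 nu ^+ 2)^-1)%:C * fourier nu x.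

Definition set_coord x (i : 'I_d) (s : R) : Rd :=
  [tuple if j == i then s else tnth x j | j < d].

Definition partial (i : 'I_d) f x : C :=
  derive1 (fun s : R => complex.Re (f (set_coord x i s)) : R) (tnth x i) +i*
  derive1 (fun s : R => complex.Im (f (set_coord x i s)) : R) (tnth x i).

Definition grad f x (i : 'I_d) : C := partial i f x.

Definition divergence (V : Rd -> 'I_d -> C) x : C :=
  \sum_(i < d) partial i (fun y => V y i) x.

Definition diffusion (a u : Rd -> C) x : C :=
  - divergence (fun y i => a y * grad u y i) x.

Section riesz.
Variables (I : choiceType) (Lambda : set I) (Phi : I -> Rd -> C).

(* Families z : I -> C only matter through their values on Lambda. *)
Definition ell2_sqnorm (z : I -> C) : \bar R :=
  \esum_(i in Lambda) ((Normc.normc (z i)) ^+ 2)%:E.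

(* f is the (unconditional) sum in L^2 of the series
   \sum_(i in Lambda) z i * Phi i: the net of its finite partial sums
   converges to f. *)
Definition L2_sum (z : I -> C) f :=
  forall e : R, 0 < e -> exists2 A0, fsets Lambda A0 &
    forall A, fsets Lambda A -> A0 `<=` A ->
      (cLnorm 2%:E (fun x => f x - \sum_(i \in A) z i * Phi i x)%R <= e%:E)%E.

Definition riesz_system (b B : R) :=
  [/\ 0 < b, b <= B, forall i, Lambda i -> L2 (Phi i) &
      forall z, (ell2_sqnorm z < +oo)%E ->
        (exists2 f, L2 f & L2_sum z f) /\
        forall f, L2 f -> L2_sum z f ->
          (b%:E * ell2_sqnorm z <= cLnorm 2%:E f ^+ 2 <= B%:E * ell2_sqnorm z)%E].

Definition bounded_riesz_system (b B K : R) :=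
  [/\ riesz_system b B, 0 < K &
      forall i, Lambda i -> (cLnorm +oo (Phi i) <= K%:E)%E].

End riesz.
End torus_functions.

(* Main.v *)
(** For [nu != 0], [Phi_nu = e0 F_nu + es c_nu F_(nu + nus)] with the real number
    [c_nu = nu . (nu + nus) / |nu|^2], and [|c_nu| <= 1 + |nus|] since [|nu| >= 1].
    A finite sum [\sum z_nu Phi_nu] is thus [e0 U + V] where, by Parseval,
    [|U| = |z|] and [|V| <= |es| (1 + |nus|) |z| <= (alpha / 2) |z|]; the triangle
    inequality gives both Riesz bounds. They make the partial sums Cauchy in L^2 for
    every square-summable [z]; the L^2 limit is built as an almost everywhere limit
    along a fast exhausting sequence of finite sets, with Fatou's lemma. *)

Require Import Defs.
From mathcomp Require Import all_boot all_order all_algebra.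
From mathcomp Require Import all_classical all_reals all_analysis.
From mathcomp Require Import measurable_realfun ess_sup_inf complex ring lra.
Set Implicit Arguments.
Unset Strict Implicit.
Unset Printing Implicit Defensive.
Import Order.TTheory GRing.Theory Num.Theory.
Import numFieldNormedType.Exports.
Import Normc.
Local Open Scope classical_set_scope.
Local Open Scope ring_scope.

(** * Trigonometric integrals over the torus *)

(** [U] and [V] may share frequencies, so they need not be orthogonal and the square of [|e0 U + V|]
    does not split; this is why the triangle inequality is used. Each of them separately has
    distinct frequencies, because translation by [nus] is injective. The lower bound obtained this
    way, [(|e0| - alpha/2)^2], equals [b_Phi + alpha^2/4]. For square-summable [z] the Riesz
    property asks two things: that an L^2 sum exists, and that every L^2 sum obeys the bounds.
    Elements of [L2] are functions, not classes, and are periodic at every point, so the limit must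
    be given everywhere by a formula in the values of the partial sums. Convergence is that of the
    net of finite subsets of [Lambda]; [Lambda] is never enumerated, and the sequence of finite sets
    is extracted from the coefficient norm alone. Complex integrals do not occur: squared moduli are
    written as real parts, and the sine part of an exponential is a cosine with a shifted phase. *)

Section trigonometric_integrals.
Variable R : realType.

Lemma cosD2piz (t : R) (k : int) : cos (t + 2 * pi * k%:~R) = cos t.
Proof.
have h n (u : R) : cos (u + 2 * pi * n%:R) = cos u.
  by rewrite -(periodicn (@cosD2pi R) n u) mulr_natl mulr_natr.
case: k => n; first exact: h.
by rewrite NegzE -(h n.+1) mulrNz mulrN subrK.
Qed.

Lemma sinD2piz (t : R) (k : int) : sin (t + 2 * pi * k%:~R) = sin t.
Proof.
have h n (u : R) : sin (u + 2 * pi * n%:R) = sin u.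
  by rewrite -(periodicn (@sinD2pi R) n u) mulr_natl mulr_natr.
case: k => n; first exact: h.
by rewrite NegzE -(h n.+1) mulrNz mulrN subrK.
Qed.

Lemma is_derive_sin_affine (a t x : R) :
  is_derive x 1 (fun s => sin (a * s + t)) (a * cos (a * x + t)).
Proof.
by apply: is_derive_eq; rewrite /GRing.scale /= mulr1 addr0 mulrC.
Qed.

Lemma is_derive_cos_affine (a t x : R) :
  is_derive x 1 (fun s => cos (a * s + t)) (- (a * sin (a * x + t))).
Proof.
by apply: is_derive_eq; rewrite /GRing.scale /= mulr1 addr0 mulNr mulrC.
Qed.

Lemma continuous_cos_affine (a t : R) : continuous (fun s => cos (a * s + t)).
Proof.
move=> x; apply: (@continuous_comp _ _ _ (fun s => a * s + t) cos).
  by apply: cvgD; [apply: cvgM; [exact: cvg_cst|exact: cvg_id]|exact: cvg_cst].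
exact: continuous_cos.
Qed.

Lemma integral_cos_period (k : int) (t : R) :
  (\int[uniform_prob (@ltr01 R)]_x (1 + cos (2 * pi * k%:~R * x + t))%:E =
   (1 + (k == 0)%:R * cos t)%:E)%E.
Proof.
have [->|k0] := eqVneq k 0.
  under eq_integral do rewrite mulr0 mul0r add0r.
  by rewrite mul1r integral_cst//= probability_setT mule1.
pose a : R := 2 * pi * k%:~R.
have a0 : a != 0.
  by rewrite !mulf_neq0 ?intr_eq0 ?(gt_eqF (pi_gt0 R)) ?pnatr_eq0.
rewrite mul0r addr0 integral_uniform; first last.
- move=> x; rewrite lee_fin -lerBlDl sub0r; exact: cos_geN1.
- apply/measurable_EFinP/measurable_funD => //.
  by apply: continuous_measurable_fun; exact: continuous_cos_affine.
rewrite subr0 invr1 mul1e.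
pose F (x : R) := x + a^-1 * sin (a * x + t).
have dF (x : R) : is_derive x 1 F (1 + cos (a * x + t)).
  have := is_derive_sin_affine a t x => H.
  by apply: is_derive_eq; rewrite /GRing.scale/= mulrA mulVf// mul1r.
have cF : continuous F.
  by move=> x; apply: differentiable_continuous; apply/derivable1_diffP; apply: ex_derive.
rewrite (@continuous_FTC2 _ _ F)//; first last.
- by move=> x _; rewrite derive1E derive_val.
- split.
  + by move=> x _; apply: ex_derive.
  + by apply: cvg_at_right_filter; exact: cF.
  + by apply: cvg_at_left_filter; exact: cF.
- apply: continuous_subspaceT => x.
  by apply: cvgD; [exact: cvg_cst|exact: continuous_cos_affine].
rewrite -EFinB /F mulr1 mulr0 [_ + t]addrC sinD2piz add0r; congr EFin.
by rewrite add0r addrK.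
Qed.

Lemma tuple_consE d (p : measurableTypeR R * Rspace R d) :
  (tnth (tuple_cons p) ord0 = p.1) *
  (forall i, tnth (tuple_cons p) (lift ord0 i) = tnth p.2 i).
Proof. by split => [|i]; rewrite ?tnth0 ?tnthS. Qed.

Lemma measurable_dot d (k : 'rV[int]_d) :
  measurable_fun [set: Rspace R d]
    (fun x => \sum_(i < d) (k 0 i)%:~R * tnth x i : R).
Proof.
apply: measurable_sum => i; apply: measurable_funM => //.
exact: measurable_tnth.
Qed.

Lemma measurable_cos_dot d (k : 'rV[int]_d) (t : R) :
  measurable_fun [set: Rspace R d]
    (fun x => cos (2 * pi * (\sum_(i < d) (k 0 i)%:~R * tnth x i) + t) : R).
Proof.
apply: (measurableT_comp (f := @cos R)).
  by apply: continuous_measurable_fun; exact: continuous_cos.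
apply: measurable_funD => //; apply: measurable_funM => //.
exact: measurable_dot.
Qed.

Lemma row0_eq (d : nat) (k : 'rV[int]_d.+1) :
  (k == 0) = (k 0 0 == 0) && (\row_i k 0 (lift ord0 i) == 0).
Proof.
apply/eqP/andP => [->|[/eqP k0 /eqP kS]].
  by rewrite mxE; split => //; apply/eqP/rowP => i; rewrite !mxE.
apply/rowP => i; rewrite [RHS]mxE.
case: (unliftP ord0 i) => [j|] ->//.
by have /rowP/(_ j) := kS; rewrite !mxE.
Qed.

(* The shift by 1 makes the integrand nonnegative, so that Tonelli's theorem
   applies without integrability side conditions. *)
Lemma integral_torus_cos d (k : 'rV[int]_d) (t : R) :
  (\int[torus_measure R d]_x
     (1 + cos (2 * pi * (\sum_(i < d) (k 0 i)%:~R * tnth x i) + t))%:E =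
   (1 + (k == 0)%:R * cos t)%:E)%E.
Proof.
(* The phase stays general in the induction: for a fixed first coordinate [s], the term
   [2 * pi * (k 0 0)%:~R * s] is absorbed into it. *)
elim: d k t => [|d IH] k t.
  rewrite /= integral_dirac//=; last first.
    by apply/measurable_EFinP/measurable_funD => //; exact: measurable_cos_dot.
  have -> : k == 0 by apply/eqP/rowP => -[].
  by rewrite diracT mul1e big_ord0 mulr0 add0r mul1r.
have m1 : measurable_fun [set: Rspace R d.+1]
  (fun x => (1 + cos (2 * pi * (\sum_(i < d.+1) (k 0 i)%:~R * tnth x i) + t))%:E).
  by apply/measurable_EFinP/measurable_funD => //; exact: measurable_cos_dot.
have p1 (u : R) : (0 <= (1 + cos u)%:E)%E.
  by rewrite lee_fin -lerBlDl sub0r; exact: cos_geN1.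
rewrite /= ge0_integral_distribution//.
rewrite fubini_tonelli1//=; last first.
  exact: (measurableT_comp m1 (@measurable_tuple_cons R d)).
pose k' : 'rV[int]_d := \row_i k 0 (lift ord0 i).
have inner (s : R) : (fubini_F (torus_measure R d)
    ((fun x : Rspace R d.+1 =>
      (1 + cos (2 * pi * (\sum_(i < d.+1) (k 0 i)%:~R * tnth x i) + t))%:E)
      \o @tuple_cons R d) s = (1 + (k' == 0)%:R * cos (2 * pi * (k 0 0)%:~R * s + t))%:E)%E.
  rewrite /fubini_F -IH; apply: eq_integral => x _ /=.
  rewrite big_ord_recl tuple_consE mulrDr mulrA -addrA addrCA.
  have -> : \sum_(i < d) (k 0 (lift ord0 i))%:~R *
      tnth (tuple_cons (s, x)) (lift ord0 i) = \sum_(i < d) (k' 0 i)%:~R * tnth x i.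
    by apply: eq_bigr => i _; rewrite tuple_consE mxE.
  by [].
under eq_integral do rewrite inner.
rewrite row0_eq -/k'; case: (k' == 0); rewrite ?andbT ?andbF/=.
  under eq_integral do rewrite mul1r.
  exact: integral_cos_period.
under eq_integral do rewrite mul0r addr0.
by rewrite integral_cst//= probability_setT mule1 mul0r addr0.
Qed.

End trigonometric_integrals.

(** * Parseval's identity for trigonometric polynomials *)

Section complex_modulus.
Variable R : rcfType.
Implicit Types x y z : R[i].

Lemma complex_ReD x y : complex.Re (x + y) = complex.Re x + complex.Re y.
Proof. by case: x; case: y. Qed.

Lemma complex_ImD x y : complex.Im (x + y) = complex.Im x + complex.Im y.
Proof. by case: x; case: y. Qed.

Lemma complex_ReB x y : complex.Re (x - y) = complex.Re x - complex.Re y.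
Proof. by case: x; case: y. Qed.

Lemma complex_ImB x y : complex.Im (x - y) = complex.Im x - complex.Im y.
Proof. by case: x; case: y. Qed.

Lemma complex_ReM x y : complex.Re (x * y) =
  complex.Re x * complex.Re y - complex.Im x * complex.Im y.
Proof. by case: x; case: y. Qed.

Lemma complex_ImM x y : complex.Im (x * y) =
  complex.Re x * complex.Im y + complex.Im x * complex.Re y.
Proof. by case: x; case: y. Qed.

Lemma complex_Re_sum (I : Type) (s : seq I) (P : pred I) (f : I -> R[i]) :
  complex.Re (\sum_(i <- s | P i) f i) = \sum_(i <- s | P i) complex.Re (f i).
Proof. by rewrite (big_morph _ complex_ReD (erefl : complex.Re (0 : R[i]) = 0)). Qed.

Lemma normc_ge0 x : 0 <= normc x.
Proof. by case: x => a b; exact: sqrtr_ge0. Qed.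

Lemma sqr_normc x : normc x ^+ 2 = complex.Re x ^+ 2 + complex.Im x ^+ 2.
Proof. by case: x => a b /=; rewrite sqr_sqrtr// addr_ge0 ?sqr_ge0. Qed.

Lemma sqr_normcJ x : normc x ^+ 2 = complex.Re (x * conjc x).
Proof. by rewrite sqr_normc; case: x => a b /=; rewrite mulrN opprK !expr2. Qed.

Lemma normc_real (r : R) : normc r%:C%C = `|r|.
Proof. by rewrite /= expr0n addr0 sqrtr_sqr. Qed.

Lemma complex_ReImE x : x = (complex.Re x +i* complex.Im x)%C.
Proof. by case: x. Qed.

End complex_modulus.

Section fourier_basis.
Variables (R : realType) (d : nat).
Implicit Types k l : 'rV[int]_d.

Lemma expiD (s t : R) : expi (s + t) = expi s * expi t.
Proof.
by rewrite /expi cosD sinD; apply/eqP; rewrite eq_complex /= addrC eqxx/= addrC.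
Qed.

Lemma normc_expi (t : R) : normc (expi t) = 1.
Proof. by rewrite /expi /= cos2Dsin2 sqrtr1. Qed.

Lemma conjc_expi (t : R) : conjc (expi t) = expi (- t).
Proof. by rewrite /expi /= cosN sinN. Qed.

Lemma fourierD k l (x : Rspace R d) : fourier (k + l) x = fourier k x * fourier l x.
Proof.
rewrite /fourier -expiD -mulrDr -big_split/=; congr (expi (_ * _)).
by apply: eq_bigr => i _; rewrite mxE intrD mulrDl.
Qed.

Lemma conjc_fourier k (x : Rspace R d) : conjc (fourier k x) = fourier (- k) x.
Proof.
rewrite /fourier conjc_expi -mulrN -sumrN; congr (expi (_ * _)).
by apply: eq_bigr => i _; rewrite mxE mulrNz mulNr.
Qed.

Lemma normc_fourier k (x : Rspace R d) : normc (fourier k x) = 1.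
Proof. exact: normc_expi. Qed.

Lemma fourier_periodic k : Defs.periodic (@fourier R d k).
Proof.
move=> x l; rewrite /fourier.
under eq_bigr do rewrite tnth_mktuple mulrDr -intrM.
rewrite big_split/= -(rmorph_sum (intr : int -> R)) mulrDr.
by rewrite /expi cosD2piz sinD2piz.
Qed.

Lemma measurable_fourier k : measurable_cfun (@fourier R d k).
Proof.
split=> /=.
  rewrite (_ : (fun _ => _) = (fun x : Rspace R d =>
    cos (2 * pi * (\sum_(i < d) (k 0 i)%:~R * tnth x i) + 0))).
    exact: measurable_cos_dot.
  by apply/funext => x; rewrite addr0.
rewrite (_ : (fun _ => _) = (fun x : Rspace R d =>
  cos (2 * pi * (\sum_(i < d) (k 0 i)%:~R * tnth x i) + - (pi / 2)))).
  exact: measurable_cos_dot.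
by apply/funext => x; rewrite cosBpihalf.
Qed.

Local Notation mu := (torus_measure R d).

Lemma integrable_cos_dot k (t : R) :
  mu.-integrable setT
    (fun x => (cos (2 * pi * (\sum_(i < d) (k 0 i)%:~R * tnth x i) + t))%:E).
Proof.
apply: (@measurable_bounded_integrable _ _ _ mu
  (fun x => cos (2 * pi * (\sum_(i < d) (k 0 i)%:~R * tnth x i) + t))) => //.
- by apply: fin_num_fun_lty; exact: fin_num_measure.
- exact: measurable_cos_dot.
exists 1; split => // M M1 x _ /=.
by apply: le_trans (ltW M1); rewrite ler_norml cos_geN1 cos_le1.
Qed.

Lemma integral_cos_dot k (t : R) :
  (\int[mu]_x (cos (2 * pi * (\sum_(i < d) (k 0 i)%:~R * tnth x i) + t))%:E =
   ((k == 0)%:R * cos t)%:E)%E.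
Proof.
have := integral_torus_cos k t.
under eq_integral do rewrite EFinD.
rewrite integralD//; last 2 first.
- by apply: finite_measure_integrable_cst.
- exact: integrable_cos_dot.
rewrite integral_cst//= probability_setT mule1 EFinD.
by move=> /(congr1 (fun u => (u - 1%:E)%E)); rewrite ![(1 + _)%E]addeC !addeK.
Qed.

(** Minus the sine is the cosine with phase [pi / 2], so the cosine integral with a free phase
    serves both parts; at frequency zero the second part contributes [cos (pi / 2) = 0]. *)
Lemma integral_Re_fourier k (w : R[i]) :
  mu.-integrable setT (fun x => (complex.Re (w * fourier k x))%:E) /\
  (\int[mu]_x (complex.Re (w * fourier k x))%:E =
    ((k == 0)%:R * complex.Re w)%:E)%E.
Proof.
have E x : ((complex.Re (w * fourier k x))%:E =
  (complex.Re w)%:E * (cos (2 * pi * (\sum_(i < d) (k 0 i)%:~R * tnth x i) + 0))%:E +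
  (complex.Im w)%:E * (cos (2 * pi * (\sum_(i < d) (k 0 i)%:~R * tnth x i) + pi / 2))%:E)%E.
  by rewrite complex_ReM /= cosDpihalf addr0 -!EFinM -EFinD mulrN.
under eq_fun do rewrite E.
have i1 := integrableZl measurableT (complex.Re w) (integrable_cos_dot k 0).
have i2 := integrableZl measurableT (complex.Im w) (integrable_cos_dot k (pi / 2)).
split; first exact: integrableD.
rewrite integralD// !integralZl//; try exact: integrable_cos_dot.
rewrite !integral_cos_dot cos0 cos_pihalf mulr0 mule0 adde0 mulr1 -EFinM.
by rewrite mulrC.
Qed.

Lemma integral_Re_trig_poly (I : Type) (s : seq I) (w : I -> R[i])
    (g : I -> 'rV[int]_d) :
  (\int[mu]_x (complex.Re (\sum_(i <- s) w i * fourier (g i) x))%:E =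
   (complex.Re (\sum_(i <- s | g i == 0) w i))%:E)%E.
Proof.
under eq_integral do rewrite complex_Re_sum -sumEFin.
rewrite integral_sum//; last first.
  by move=> i; exact: (integral_Re_fourier (g i) (w i)).1.
rewrite complex_Re_sum -sumEFin [RHS]big_mkcond/=; apply: eq_bigr => i _.
rewrite (integral_Re_fourier (g i) (w i)).2.
by case: ifP; rewrite ?mul1r ?mul0r.
Qed.

(** The squared modulus is the real part of a double sum with frequencies [g i - g j]; by
    injectivity only the diagonal survives integration. The map [g] makes the statement apply both
    to the frequencies [nu] and to the translated ones [nu + l]. *)
Lemma integral_sqr_trig_poly (I : eqType) (s : seq I) (w : I -> R[i])
    (g : I -> 'rV[int]_d) : injective g -> uniq s ->
  (\int[mu]_x (normc (\sum_(i <- s) w i * fourier (g i) x) ^+ 2)%:E =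
   (\sum_(i <- s) normc (w i) ^+ 2)%:E)%E.
Proof.
move=> g_inj us.
pose t := [seq (i, j) | i <- s, j <- s].
have E x : normc (\sum_(i <- s) w i * fourier (g i) x) ^+ 2 =
    complex.Re (\sum_(p <- t)
      (w p.1 * conjc (w p.2)) * fourier (g p.1 - g p.2) x).
  rewrite sqr_normcJ; congr complex.Re.
  rewrite rmorph_sum big_distrlr /= big_allpairs_dep.
  apply: eq_bigr => i _; apply: eq_bigr => j _ /=.
  by rewrite rmorphM/= fourierD -conjc_fourier mulrACA.
under eq_integral do rewrite E.
rewrite (integral_Re_trig_poly t (fun p => w p.1 * conjc (w p.2))
  (fun p => g p.1 - g p.2)).
congr EFin; rewrite big_mkcond big_allpairs_dep complex_Re_sum.
apply: eq_big_seq => i si; rewrite sqr_normcJ; congr complex.Re.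
rewrite (bigD1_seq i)//= subrr eqxx big1 ?addr0// => j ji.
by rewrite subr_eq0 (inj_eq g_inj) eq_sym (negbTE ji).
Qed.

End fourier_basis.

(** * Completeness of L^2 *)

Section riesz_fischer.
Context d (T : measurableType d) (R : realType) (mu : probability T R).
Variables (g : nat -> T -> R) (C : R).
Hypothesis mg : forall n, measurable_fun setT (g n).
Hypothesis g_cauchy : forall n m, (n <= m)%N ->
  (\int[mu]_x ((g m x - g n x) ^+ 2)%:E <= (C / 4 ^+ n)%:E)%E.

(** The sum [G] of the increments [|g n.+1 - g n|] has integral at most [4 * C + 1], hence is finite
    almost everywhere; where it is finite, the telescoping series of [g] converges absolutely. *)
Lemma geometric_ae_cvg : \forall x \ae mu, cvgn (g ^~ x).
Proof.
pose h n x := `|g n.+1 x - g n x|.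
have mh n : measurable_fun setT (fun x => (h n x)%:E).
  apply/measurable_EFinP; apply: (measurableT_comp (@normr_measurable R setT)).
  exact: measurable_funB.
have h0 n x : (0 <= (h n x)%:E)%E by rewrite lee_fin normr_ge0.
have C0 : 0 <= C.
  rewrite -[C]divr1 -(expr0 4) -lee_fin.
  apply: le_trans (g_cauchy (leqnn 0)).
  by apply: integral_ge0 => x _; rewrite lee_fin sqr_ge0.
have int_h n : (\int[mu]_x (h n x)%:E <= ((4 * C + 1) / (2 ^ n.+1)%:R)%:E)%E.
  have p0 : 0 < (2 ^ n.+1)%:R :> R by rewrite ltr0n expn_gt0.
  pose w : R := (2 ^ n.+1)%:R.
  apply: (@le_trans _ _ (\int[mu]_x
      (w%:E * ((g n.+1 x - g n x) ^+ 2)%:E + (w^-1)%:E))%E).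
    apply: ge0_le_integral => //.
      apply: emeasurable_funD => //; apply: measurable_funeM.
      by apply/measurable_EFinP; apply: measurable_funX; exact: measurable_funB.
    move=> x _; rewrite -EFinM -EFinD lee_fin /h -[X in w * X]real_normK ?num_real//.
    (* AM-GM: [t <= w t^2 + 1 / w], with [w = 2^(n+1)] to keep the bound summable. *)
    set t := `|_|; have t0 : 0 <= t by rewrite normr_ge0.
    have -> : w * t ^+ 2 + w^-1 = w * (t - w^-1 / 2) ^+ 2 + t + 3 / 4 * w^-1.
      by field; rewrite /w gt_eqF.
    have : 0 <= w * (t - w^-1 / 2) ^+ 2 by rewrite mulr_ge0 ?sqr_ge0// ltW.
    have : 0 < w^-1 by rewrite invr_gt0.
    lra.
  have msq : measurable_fun setT (fun x => ((g n.+1 x - g n x) ^+ 2)%:E).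
    by apply/measurable_EFinP; apply: measurable_funX; exact: measurable_funB.
  have sq0 x : setT x -> (0 <= ((g n.+1 x - g n x) ^+ 2)%:E)%E.
    by rewrite lee_fin sqr_ge0.
  have mwsq := measurable_funeM w%:E msq.
  have wsq0 x : setT x -> (0 <= w%:E * ((g n.+1 x - g n x) ^+ 2)%:E)%E.
    by move=> /sq0; apply: mule_ge0; rewrite lee_fin ltW.
  have int_cst (r : R) : (\int[mu]_x r%:E = r%:E)%E.
    rewrite integral_cst// -[RHS]mule1; congr (_ * _)%E; exact: probability_setT.
  have w0 : (0 <= w%:E)%E by rewrite lee_fin ltW.
  have winv0 x : [set: T] x -> (0 <= (w^-1)%:E)%E by rewrite lee_fin invr_ge0 ltW.
  rewrite ge0_integralD// int_cst ge0_integralZl//.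
  rewrite mulrDl EFinD mul1r leeD2r//.
  apply: (@le_trans _ _ (w%:E * (C / 4 ^+ n)%:E)%E).
    by rewrite lee_pmul2l//; exact: g_cauchy.
  rewrite -EFinM lee_fin /w natrX exprS.
  have -> : 4 ^+ n = 2 ^+ n * 2 ^+ n :> R by rewrite -exprMn; congr (_ ^+ n); ring.
  have q0 : 2 ^+ n != 0 :> R by rewrite expf_neq0// pnatr_eq0.
  rewrite le_eqVlt; apply/orP; left; apply/eqP; field.
  by rewrite q0.
pose G x := (\sum_(n <oo) (h n x)%:E)%E.
have mG : measurable_fun setT G.
  by apply: ge0_emeasurable_sum => //.
have iG : mu.-integrable setT G.
  apply/integrableP; split => //.
  under eq_integral do rewrite gee0_abs ?nneseries_ge0//.
  rewrite integral_nneseries//.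
  apply: (@le_lt_trans _ _ (4 * C + 1)%:E); last exact: ltry.
  apply: le_trans (epsilon_trick0 xpredT _); last by rewrite addr_ge0 ?mulr_ge0.
  apply: lee_nneseries => [i _ _|i _]; last exact: int_h.
  exact: integral_ge0.
apply: filterS (integrable_ae measurableT iG) => x /(_ I) Gx.
have cs : cvgn (series (telescope (g ^~ x))).
  apply: normed_cvg; apply: nondecreasing_is_cvgn.
    by apply: nondecreasing_series => n _ _; rewrite normr_ge0.
  exists (fine (G x)) => _ [n _ <-].
  rewrite -lee_fin fineK// /series /= -sumEFin.
  exact: (nneseries_lim_ge n (fun i _ _ => h0 i x)).
rewrite telescopeK in cs.
rewrite (_ : g ^~ x = (fun n => g n x - g 0%N x) \+ cst (g 0%N x)).
  exact: is_cvgD cs (is_cvg_cst _).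
by apply/funext => n /=; rewrite subrK.
Qed.

(* Everywhere defined and measurable, also off the convergence set, and a function
   of the sequence of values only: periodicity of the [g n] is inherited. *)
Definition pointwise_limit (x : T) : R := fine (limn_esup (fun n => (g n x)%:E)).

Lemma measurable_pointwise_limit : measurable_fun setT pointwise_limit.
Proof.
apply: (measurableT_comp (f := fine)); first exact: fine_measurable.
by apply: measurable_fun_limn_esup => n; exact/measurable_EFinP.
Qed.

Lemma pointwise_limitE x : cvgn (g ^~ x) -> g ^~ x @ \oo --> pointwise_limit x.
Proof.
move=> cg; rewrite /pointwise_limit.
have H : (fun n => (g n x)%:E) @ \oo --> (limn (g ^~ x))%:E.
  by apply: cvg_EFin; [exact: nearW|exact: cg].
by rewrite (cvg_limn_einf_sup H).2; exact: cg.
Qed.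

(** Fatou's lemma carries the Cauchy bound between [g n] and [g (n + m)] to the limit in [m]. The
    lower limit it produces equals the squared distance to [pointwise_limit] only on the convergence
    set, which is enough for the integral. *)
Lemma pointwise_limit_rate n :
  (\int[mu]_x ((pointwise_limit x - g n x) ^+ 2)%:E <= (C / 4 ^+ n)%:E)%E.
Proof.
pose F m x := ((g (n + m)%N x - g n x) ^+ 2)%:E.
have mF m : measurable_fun setT (F m).
  by apply/measurable_EFinP; apply: measurable_funX; exact: measurable_funB.
have F0 m x : (0 <= F m x)%E by rewrite lee_fin sqr_ge0.
apply: (@le_trans _ _ (\int[mu]_x limn_einf (F ^~ x))%E); last first.
  apply: (le_trans (fatou mu measurableT mF (fun m x _ => F0 m x))).
  rewrite limn_einf_lim; apply: lime_le; first exact: is_cvg_einfs.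
  apply: nearW => m; rewrite /einfs /=.
  apply: (@le_trans _ _ (\int[mu]_x F m x)%E).
    by apply: ereal_inf_lbound; exists m => /=.
  by apply: g_cauchy; rewrite leq_addr.
rewrite le_eqVlt; apply/orP; left; apply/eqP; apply: ge0_ae_eq_integral => //.
- apply/measurable_EFinP; apply: measurable_funX; apply: measurable_funB => //.
  exact: measurable_pointwise_limit.
- apply: (measurableT_comp (f := -%E)); first exact: oppe_measurable.
  apply: measurable_fun_limn_esup => m.
  by apply: (measurableT_comp (f := -%E)) => //; exact: oppe_measurable.
- by move=> x _; rewrite lee_fin sqr_ge0.
- move=> x _; rewrite limn_einf_lim; apply: lime_ge; first exact: is_cvg_einfs.
  by apply: nearW => m; apply: le_ereal_inf_tmp => _ [k _ <-].
apply: filterS geometric_ae_cvg => x /pointwise_limitE gx _; apply/esym.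
suff H : F ^~ x @ \oo --> ((pointwise_limit x - g n x) ^+ 2)%:E.
  by rewrite (cvg_limn_einf_sup H).1.
apply: cvg_EFin; first exact: nearW.
have gx' : (fun m => g (n + m)%N x - g n x) @ \oo --> pointwise_limit x - g n x.
  apply: cvgB; last exact: cvg_cst.
  exact: (cvg_comp (addn n) (g ^~ x) (cvg_addnl n) gx).
rewrite expr2; under eq_fun do rewrite /F /= expr2.
exact: cvgM.
Qed.

End riesz_fischer.

(** * The L^2 norm of complex functions *)

Section square_norm.
Variables (R : realType) (d : nat).
Implicit Types f h : Rspace R d -> R[i].
Local Notation mu := (torus_measure R d).

Lemma measurable_normc f : measurable_cfun f ->
  measurable_fun setT (fun x => normc (f x)).
Proof.
move=> [mRe mIm].
rewrite (_ : (fun _ => _) =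
    Num.sqrt \o (fun x => complex.Re (f x) ^+ 2 + complex.Im (f x) ^+ 2)).
  apply: (measurableT_comp (continuous_measurable_fun (@sqrt_continuous R))).
  by apply: measurable_funD; apply: measurable_funX.
by apply/funext => x /=; case: (f x).
Qed.

Lemma measurable_cfunD f h : measurable_cfun f -> measurable_cfun h ->
  measurable_cfun (fun x => f x + h x).
Proof.
move=> [mfr mfi] [mhr mhi]; split.
  by under eq_fun do rewrite complex_ReD; exact: measurable_funD.
by under eq_fun do rewrite complex_ImD; exact: measurable_funD.
Qed.

Lemma measurable_cfunZ (c : R[i]) f : measurable_cfun f ->
  measurable_cfun (fun x => c * f x).
Proof.
move=> [mfr mfi]; split.
  under eq_fun do rewrite complex_ReM.
  by apply: measurable_funB; apply: measurable_funM.
under eq_fun do rewrite complex_ImM.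
by apply: measurable_funD; apply: measurable_funM.
Qed.

Lemma measurable_cfunB f h : measurable_cfun f -> measurable_cfun h ->
  measurable_cfun (fun x => f x - h x).
Proof.
move=> mf /(measurable_cfunZ (-1)) mh.
by under eq_fun do rewrite -mulN1r; exact: measurable_cfunD.
Qed.

Lemma measurable_cfun_sum (I : eqType) (s : seq I) (f : I -> Rspace R d -> R[i]) :
  {in s, forall i, measurable_cfun (f i)} ->
  measurable_cfun (fun x => \sum_(i <- s) f i x).
Proof.
elim: s => [_|i s IH mf].
  by under eq_fun do rewrite big_nil; split; exact: measurable_cst.
under eq_fun do rewrite big_cons.
apply: measurable_cfunD; first by apply: mf; rewrite mem_head.
by apply: IH => j js; apply: mf; rewrite inE js orbT.
Qed.

Lemma cLnorm_ge0 p f : (0 <= cLnorm p f)%E.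
Proof. exact: Lnorm_ge0. Qed.

Lemma sqr_cLnorm2 f :
  (cLnorm 2%:E f ^+ 2 = \int[mu]_x (normc (f x) ^+ 2)%:E)%E.
Proof.
have -> : (\int[mu]_x (normc (f x) ^+ 2)%:E =
    \int[mu]_x (`|(normc (f x))%:E| `^ 2))%E.
  apply: eq_integral => x _.
  by rewrite gee0_abs ?lee_fin ?normc_ge0// poweR_EFin powR_mulrn ?normc_ge0.
have I0 : (0 <= \int[mu]_x (`|(normc (f x))%:E| `^ 2))%E.
  by apply: integral_ge0 => x _; exact: poweR_ge0.
by rewrite -[RHS](sqr_sqrte I0) -poweR12_sqrt// /cLnorm unlock.
Qed.

Lemma le_cLnorm2 f (r : R) : 0 <= r ->
  (\int[mu]_x (normc (f x) ^+ 2)%:E <= (r ^+ 2)%:E)%E -> (cLnorm 2%:E f <= r%:E)%E.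
Proof.
move=> r0; rewrite -sqr_cLnorm2 EFin_expe; exact: lee_sqrE.
Qed.

(** Minkowski's inequality is applied to the real functions [|f|] and [|h|], after the pointwise
    bound of [|f + h|] by [|f| + |h|]. *)
Lemma cLnorm2D f h : measurable_cfun f -> measurable_cfun h ->
  (cLnorm 2%:E (fun x => f x + h x)%R <= cLnorm 2%:E f + cLnorm 2%:E h)%E.
Proof.
move=> mf mh; have mnf := measurable_normc mf; have mnh := measurable_normc mh.
apply: (@le_trans _ _ (Lnorm mu 2%:E
  (EFin \o ((fun x => normc (f x)) \+ (fun x => normc (h x)))))); last first.
  by apply: (minkowski_EFin mu mnf mnh); rewrite ler1n.
have nfh0 x : 0 <= normc (f x) + normc (h x) by rewrite addr_ge0 ?normc_ge0.
rewrite /cLnorm unlock; apply: gt0_ler_poweR; first by rewrite invr_ge0.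
- by rewrite in_itv/= leey andbT; apply: integral_ge0 => x _; rewrite lee_fin powR_ge0.
- by rewrite in_itv/= leey andbT; apply: integral_ge0 => x _; rewrite lee_fin powR_ge0.
have mpow (u : Rspace R d -> R) : measurable_fun setT u ->
    measurable_fun setT (fun x => (`|(u x)%:E| `^ 2)%E).
  move=> mu'; under eq_fun do rewrite abse_EFin poweR_EFin powR_mulrn//.
  apply/measurable_EFinP; apply: measurable_funX.
  exact: (measurableT_comp (@normr_measurable R setT)).
apply: ge0_le_integral => //.
- by move=> x _; exact: poweR_ge0.
- by apply: (mpow (fun x => normc (f x + h x)));
    exact: measurable_normc (measurable_cfunD mf mh).
- by apply: (mpow (fun x => normc (f x) + normc (h x))); exact: measurable_funD.
move=> x _ /=; rewrite lee_fin !powR_mulrn// !ger0_norm ?nfh0 ?normc_ge0//.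
by rewrite ler_sqr ?nnegrE ?nfh0 ?normc_ge0 ?le_normcD.
Qed.

Lemma cLnorm2Z (c : R[i]) f : measurable_cfun f ->
  (cLnorm 2%:E (fun x => c * f x)%R = (normc c)%:E * cLnorm 2%:E f)%E.
Proof.
move=> mf; have mnf := measurable_normc mf.
have sqr_eq (u v : \bar R) : (0 <= u -> 0 <= v -> u ^+ 2 = v ^+ 2 -> u = v)%E.
  move=> u0 v0 uv; apply/eqP; rewrite eq_le.
  by apply/andP; split; apply: lee_sqrE; rewrite ?uv.
apply: sqr_eq; first exact: cLnorm_ge0.
  by apply: mule_ge0; [rewrite lee_fin normc_ge0|exact: cLnorm_ge0].
rewrite sqr_cLnorm2 [RHS]expe2 muleACA -EFinM -!expe2 sqr_cLnorm2 -ge0_integralZl//; first last.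
- by rewrite lee_fin sqr_ge0.
- by move=> x _; rewrite lee_fin sqr_ge0.
- by apply/measurable_EFinP; exact: measurable_funX.
by apply: eq_integral => x _; rewrite normcM exprMn EFinM.
Qed.

Lemma cLnormN p f : cLnorm p (fun x => - f x) = cLnorm p f.
Proof. by rewrite /cLnorm; under eq_fun do rewrite normcN. Qed.

Lemma cLnorm2_trig_poly (I : eqType) (s : seq I) (w : I -> R[i])
    (g : I -> 'rV[int]_d) : injective g -> uniq s ->
  (cLnorm 2%:E (fun x => \sum_(i <- s) w i * fourier (g i) x)%R =
   (Num.sqrt (\sum_(i <- s) normc (w i) ^+ 2))%:E)%E.
Proof.
move=> gi us.
have s0 : 0 <= \sum_(i <- s) normc (w i) ^+ 2.
  by apply: sumr_ge0 => i _; rewrite sqr_ge0.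
apply/eqP; rewrite eq_le; apply/andP; split; apply: lee_sqrE.
- by rewrite lee_fin sqrtr_ge0.
- by rewrite sqr_cLnorm2 (integral_sqr_trig_poly w gi us) -EFin_expe sqr_sqrtr.
- exact: cLnorm_ge0.
- by rewrite sqr_cLnorm2 (integral_sqr_trig_poly w gi us) -EFin_expe sqr_sqrtr.
Qed.

End square_norm.

(** * The diffusion operator on the Fourier basis *)

Section diffusion_of_Psi.
Variables (R : realType) (d : nat).
Implicit Types (k l nu : 'rV[int]_d) (x : Rspace R d) (c : R[i]).

Definition dotz k l : R := \sum_(i < d) (k 0 i)%:~R * (l 0 i)%:~R.

Lemma sqr_norm2 nu : norm2 R nu ^+ 2 = \sum_(i < d) (nu 0 i)%:~R ^+ 2.
Proof. by rewrite sqr_sqrtr// sumr_ge0// => i _; rewrite sqr_ge0. Qed.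

Lemma dotzz nu : dotz nu nu = norm2 R nu ^+ 2.
Proof. by rewrite sqr_norm2; apply: eq_bigr => i _; rewrite expr2. Qed.

(** Some coordinate is a nonzero integer, and its square alone is at least 1. *)
Lemma norm2_ge1 nu : nu != 0 -> 1 <= norm2 R nu.
Proof.
move=> nu0.
have [i nui] : exists i, nu 0 i != 0.
  apply/existsP; apply: contraNT nu0; rewrite negb_exists => /forallP nu0.
  by apply/eqP/rowP => i; rewrite mxE; apply/eqP; have := nu0 i; rewrite negbK.
rewrite -(@ler_pXn2r _ 2)// ?nnegrE ?sqrtr_ge0// expr1n sqr_norm2 (bigD1 i)//=.
rewrite -[leLHS]addr0 lerD//; last by apply: sumr_ge0 => j _; rewrite sqr_ge0.
rewrite -[leRHS]real_normK ?num_real// exprn_ege1//.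
by rewrite -intr_norm -[1]/(1%:~R) ler_int -gtz0_ge1 normr_gt0.
Qed.

(** The squared length of [|nu|^2 l - (nu . l) nu] is nonnegative and expands to
    [|nu|^2 (|nu|^2 |l|^2 - (nu . l)^2)]; the factor [|nu|^2] is positive and cancels. *)
Lemma cauchy_schwarz_dotz nu l : nu != 0 -> `|dotz nu l| <= norm2 R nu * norm2 R l.
Proof.
move=> /norm2_ge1 nu1.
have A0 : 0 < norm2 R nu ^+ 2 by rewrite exprn_gt0// (lt_le_trans ltr01).
rewrite -(@ler_pXn2r _ 2)// ?nnegrE ?mulr_ge0 ?sqrtr_ge0//.
rewrite real_normK ?num_real// exprMn -(ler_pM2l A0).
have : 0 <= \sum_(i < d) (norm2 R nu ^+ 2 * (l 0 i)%:~R - dotz nu l * (nu 0 i)%:~R) ^+ 2.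
  by apply: sumr_ge0 => i _; rewrite sqr_ge0.
under eq_bigr => i _.
  rewrite (_ : _ ^+ 2 = (norm2 R nu ^+ 2) ^+ 2 * (l 0 i)%:~R ^+ 2 -
    2 * norm2 R nu ^+ 2 * dotz nu l * ((nu 0 i)%:~R * (l 0 i)%:~R) +
    dotz nu l ^+ 2 * (nu 0 i)%:~R ^+ 2); last by ring.
  over.
rewrite big_split/= sumrB -!mulr_sumr -!sqr_norm2 -/(dotz nu l); nra.
Qed.

(** The imaginary number [0 +i* freq k i] is the eigenvalue of [partial i] on [fourier k]. *)
Definition freq k (i : 'I_d) : R := 2 * pi * (k 0 i)%:~R.

Lemma fourier_set_coord k x (i : 'I_d) (s : R) :
  fourier k (set_coord x i s) =
  expi (freq k i * s + 2 * pi * \sum_(j < d | j != i) (k 0 j)%:~R * tnth x j).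
Proof.
rewrite /fourier (bigD1 i)//= tnth_mktuple eqxx mulrDr mulrA.
congr (expi (_ + _ * _)); apply: eq_bigr => j ji.
by rewrite tnth_mktuple (negbTE ji).
Qed.

Lemma set_coord_id x (i : 'I_d) : set_coord x i (tnth x i) = x.
Proof.
by apply: eq_from_tnth => j; rewrite tnth_mktuple; case: eqP => // ->.
Qed.

Lemma is_derive_Re_fourier c k x (i : 'I_d) :
  is_derive (tnth x i) 1 (fun s => complex.Re (c * fourier k (set_coord x i s)))
    (complex.Re ((0 +i* freq k i)%C * (c * fourier k x))).
Proof.
rewrite -[in fourier k x](set_coord_id x i).
under eq_fun do rewrite fourier_set_coord complex_ReM /=.
rewrite fourier_set_coord; set a := freq k i; set t := 2 * pi * _.
have H1 := is_derive_cos_affine a t (tnth x i).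
have H2 := is_derive_sin_affine a t (tnth x i).
apply: is_derive_eq; rewrite complex_ReM complex_ImM /= /GRing.scale /=; ring.
Qed.

Lemma is_derive_Im_fourier c k x (i : 'I_d) :
  is_derive (tnth x i) 1 (fun s => complex.Im (c * fourier k (set_coord x i s)))
    (complex.Im ((0 +i* freq k i)%C * (c * fourier k x))).
Proof.
rewrite -[in fourier k x](set_coord_id x i).
under eq_fun do rewrite fourier_set_coord complex_ImM /=.
rewrite fourier_set_coord; set a := freq k i; set t := 2 * pi * _.
have H1 := is_derive_cos_affine a t (tnth x i).
have H2 := is_derive_sin_affine a t (tnth x i).
apply: is_derive_eq; rewrite complex_ImM complex_ReM complex_ImM /= /GRing.scale /=; ring.
Qed.

(** [derive1] is additive only on differentiable functions, so linearity is proved for the shape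
    that the flux [a * grad Psi] has, a combination of two exponentials. *)
Lemma partial_fourier2 c1 c2 k l x (i : 'I_d) :
  partial i (fun y => c1 * fourier k y + c2 * fourier l y) x =
  (0 +i* freq k i)%C * (c1 * fourier k x) + (0 +i* freq l i)%C * (c2 * fourier l x).
Proof.
rewrite /partial [RHS]complex_ReImE complex_ReD complex_ImD.
have Hk := is_derive_Re_fourier c1 k x i; have Hl := is_derive_Re_fourier c2 l x i.
have Ik := is_derive_Im_fourier c1 k x i; have Il := is_derive_Im_fourier c2 l x i.
rewrite !derive1E; congr (_ +i* _)%C.
  by under eq_fun do rewrite complex_ReD; apply: derive_val.
by under eq_fun do rewrite complex_ImD; apply: derive_val.
Qed.

Lemma partial_fourier c k x (i : 'I_d) :
  partial i (fun y => c * fourier k y) x = (0 +i* freq k i)%C * (c * fourier k x).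
Proof.
have := partial_fourier2 c 0 k k x i; rewrite !mul0r mulr0 addr0 => <-.
by congr (partial i _ x); apply/funext => y; rewrite mul0r addr0.
Qed.

(* The coefficient [nu . (nu + l) / |nu|^2]. *)
Definition coupling nu l : R := 1 + dotz nu l / norm2 R nu ^+ 2.

(** The gradient brings out [freq nu]; the divergence brings out [freq nu] on the constant part of
    the coefficient and [freq (nu + l)] on the oscillating part. The normalization [kappa] of [Psi]
    turns the two sums of products into [1] and [coupling nu l]. At [nu + l = 0] the coupling
    vanishes, so this case needs no separate treatment. *)
Lemma diffusion_Psi (e0 es : R[i]) (l nu : 'rV[int]_d) x : nu != 0 ->
  diffusion (fun y => e0 + es * fourier l y) (@Psi R d nu) x =
  e0 * fourier nu x + es * (coupling nu l)%:C%C * fourier (nu + l) x.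
Proof.
move=> nu0; have n1 := norm2_ge1 nu0.
have n0 : norm2 R nu != 0 by rewrite gt_eqF// (lt_le_trans ltr01).
have p0 : pi != 0 :> R by rewrite gt_eqF// pi_gt0.
pose kappa : R := (4 * pi ^+ 2 * norm2 R nu ^+ 2)^-1.
rewrite /diffusion /divergence.
have E (i : 'I_d) : (fun y => (e0 + es * fourier l y) * grad (@Psi R d nu) y i) =
  (fun y => (e0 * ((0 +i* freq nu i)%C * kappa%:C%C)) * fourier nu y +
            (es * ((0 +i* freq nu i)%C * kappa%:C%C)) * fourier (nu + l) y).
  apply/funext => y; rewrite /grad /Psi partial_fourier fourierD -/kappa; ring.
under eq_bigr do rewrite E partial_fourier2.
have sq (u v : R) : (0 +i* u)%C * (0 +i* v)%C = - (u * v)%:C%C.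
  by apply/eqP; rewrite eq_complex /= !mul0r mulr0 addr0 sub0r oppr0 !eqxx.
under eq_bigr => i _.
  rewrite (_ : _ + _ =
     - (freq nu i * freq nu i)%:C%C * (kappa%:C%C * (e0 * fourier nu x)) +
     - (freq (nu + l) i * freq nu i)%:C%C * (kappa%:C%C * (es * fourier (nu + l) x))); last first.
    by rewrite -!sq; ring.
  over.
rewrite big_split/= -!mulr_suml !sumrN !mulNr -!rmorph_sum/=.
have -> : \sum_(i < d) freq nu i * freq nu i = kappa^-1.
  rewrite /kappa invrK -dotzz mulr_sumr; apply: eq_bigr => i _.
  by rewrite /freq; ring.
have -> : \sum_(i < d) freq (nu + l) i * freq nu i = kappa^-1 * coupling nu l.
  rewrite /kappa invrK /coupling.
  have -> : 4 * pi ^+ 2 * norm2 R nu ^+ 2 * (1 + dotz nu l / norm2 R nu ^+ 2) =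
    4 * pi ^+ 2 * (dotz nu nu + dotz nu l) by rewrite dotzz; field.
  rewrite -big_split mulr_sumr; apply: eq_bigr => i _ /=.
  by rewrite /freq mxE intrD; ring.
have k0 : kappa != 0 by rewrite invr_eq0 !mulf_neq0 ?expf_neq0// pnatr_eq0.
have kC : kappa^-1%:C%C * kappa%:C%C = 1 by rewrite -rmorphM/= mulVf.
rewrite rmorphM/=; ring: kC.
Qed.

Lemma normr_coupling nu l : nu != 0 -> `|coupling nu l| <= 1 + norm2 R l.
Proof.
move=> nu0; have n1 := norm2_ge1 nu0.
have n0 : 0 < norm2 R nu by exact: lt_le_trans ltr01 n1.
apply: le_trans (ler_normD _ _) _; rewrite normr1 lerD2l normrM normfV.
rewrite (ger0_norm (sqr_ge0 _)) ler_pdivrMr ?exprn_gt0//.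
apply: le_trans (cauchy_schwarz_dotz l nu0) _.
rewrite mulrC ler_wpM2l ?sqrtr_ge0// expr2 ler_peMr// ltW//.
Qed.

End diffusion_of_Psi.

(** * Riesz bounds from finite sums *)

Section riesz_system_from_finite_sums.
Variables (R : realType) (d : nat) (I : choiceType) (Lambda : set I).
Variables (Phi : I -> Rspace R d -> R[i]) (b B : R).
Local Notation mu := (torus_measure R d).

Definition finite_sum (z : I -> R[i]) (A : set I) (x : Rspace R d) : R[i] :=
  \sum_(i \in A) z i * Phi i x.

Definition finite_sqnorm (z : I -> R[i]) (A : set I) : R :=
  \sum_(i \in A) normc (z i) ^+ 2.

Hypothesis b_gt0 : 0 < b.
Hypothesis le_bB : b <= B.
Hypothesis Phi_periodic : forall i, Lambda i -> Defs.periodic (Phi i).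
Hypothesis Phi_measurable : forall i, Lambda i -> measurable_cfun (Phi i).
Hypothesis finite_bounds : forall z A, fsets Lambda A ->
  ((b * finite_sqnorm z A)%:E <= cLnorm 2%:E (finite_sum z A) ^+ 2 <=
   (B * finite_sqnorm z A)%:E)%E.

Let B_gt0 : 0 < B. Proof. exact: lt_le_trans le_bB. Qed.

Lemma fsbigB (V : zmodType) (F : I -> V) (A A' : set I) :
  finite_set A -> A' `<=` A ->
  \sum_(i \in A) F i - \sum_(i \in A') F i = \sum_(i \in A `\` A') F i.
Proof.
move=> fA A'A; rewrite (fsbigID A' A F fA) setIidr// setDE.
by rewrite [X in X - _]addrC addrK.
Qed.

Lemma finite_sqnorm_ge0 z A : finite_set A -> 0 <= finite_sqnorm z A.
Proof.
by move=> fA; rewrite /finite_sqnorm fsbig_finite// sumr_ge0// => i _; rewrite sqr_ge0.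
Qed.

Lemma measurable_finite_sum z A : fsets Lambda A -> measurable_cfun (finite_sum z A).
Proof.
move=> [fA AL]; rewrite /finite_sum; under eq_fun do rewrite fsbig_finite//.
apply: measurable_cfun_sum => i; rewrite in_fset_set// inE => /AL /Phi_measurable.
exact: measurable_cfunZ.
Qed.

Lemma periodic_finite_sum z A : fsets Lambda A -> Defs.periodic (finite_sum z A).
Proof.
move=> [fA AL] x k; apply: eq_fsbigr => i; rewrite inE => /AL Li.
by rewrite Phi_periodic.
Qed.

(** The difference of nested partial sums is the partial sum over [A] minus [A'], to which the upper
    bound applies. *)
Lemma finite_sum_dist z A A' : fsets Lambda A -> fsets Lambda A' -> A' `<=` A ->
  (\int[mu]_x (normc (finite_sum z A x - finite_sum z A' x) ^+ 2)%:E <=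
   (B * (finite_sqnorm z A - finite_sqnorm z A'))%:E)%E.
Proof.
move=> [fA AL] [fA' A'L] A'A.
rewrite /finite_sum; under eq_integral do rewrite fsbigB//.
rewrite /finite_sqnorm fsbigB// -sqr_cLnorm2.
have LD : fsets Lambda (A `\` A').
  by split; [exact: finite_setD|move=> i [/AL]].
by have /andP[] := finite_bounds z LD.
Qed.

(** Finiteness of the norm is the upper bound for the singleton of [i] with coefficient 1. *)
Lemma L2_Phi i : Lambda i -> L2 (Phi i).
Proof.
move=> Li; split; [exact: Phi_periodic|exact: Phi_measurable|].
have L1 : fsets Lambda [set i] by split; [exact: finite_set1|move=> _ ->].
have /andP[_] := finite_bounds (fun=> 1) L1.
rewrite (_ : finite_sum _ _ = Phi i); last first.
  by apply/funext => x; rewrite /finite_sum fsbig_set1 mul1r.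
have := cLnorm_ge0 2%:E (Phi i).
by case: (cLnorm _ _) => [r| |]//; rewrite ltry.
Qed.

Section fixed_coefficients.
Variable z : I -> R[i].
Hypothesis z_ell2 : (ell2_sqnorm Lambda z < +oo)%E.

Let Q : R := fine (ell2_sqnorm Lambda z).

Let QE : ell2_sqnorm Lambda z = Q%:E.
Proof.
rewrite fineK// ge0_fin_numE//; apply: esum_ge0 => i _.
by rewrite lee_fin sqr_ge0.
Qed.

Lemma finite_sqnorm_le A : fsets Lambda A -> finite_sqnorm z A <= Q.
Proof.
move=> LA; rewrite -lee_fin -QE; apply: ereal_sup_ubound; exists A => //.
by rewrite fsumEFin//; case: LA.
Qed.

Lemma finite_sqnorm_approx (e : R) : 0 < e ->
  exists2 A, fsets Lambda A & Q - e < finite_sqnorm z A.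
Proof.
move=> e0; have := @ub_ereal_sup_adherent R _ e e0.
move=> /(_ [set (\sum_(x \in A) ((normc (z x)) ^+ 2)%:E)%E | A in fsets Lambda]).
rewrite -[ereal_sup _]/(ell2_sqnorm Lambda z) QE => /(_ isT)[_ [A LA <-]].
rewrite fsumEFin; last exact: LA.1.
by rewrite -EFinB lte_fin => h; exists A.
Qed.

Lemma finite_sqnorm_mono A A' : finite_set A -> A' `<=` A ->
  finite_sqnorm z A' <= finite_sqnorm z A.
Proof.
move=> fA A'A; rewrite -subr_ge0 /finite_sqnorm fsbigB//.
by apply: finite_sqnorm_ge0; exact: finite_setD.
Qed.

(** Near-maximizers of the supremum defining the coefficient norm are made nested by taking unions.
    They need not exhaust [Lambda], only the norm. The rate [4 ^- n] for squares is the one required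
    for almost everywhere convergence. *)
Lemma exhausting_fsets : exists2 A_ : nat -> set I,
  (forall n, fsets Lambda (A_ n)) /\ (forall n m, (n <= m)%N -> A_ n `<=` A_ m) &
  forall n, Q - (4 ^+ n)^-1 < finite_sqnorm z (A_ n).
Proof.
have /choice[A hA] : forall n, exists A,
    fsets Lambda A /\ Q - (4 ^+ n)^-1 < finite_sqnorm z A.
  move=> n; have [|A ? ?] := @finite_sqnorm_approx (4 ^+ n)^-1; last by exists A.
  by rewrite invr_gt0 exprn_gt0.
have fin n : fsets Lambda (\big[setU/set0]_(k < n) A k).
  split.
    by elim/big_ind : _ => // [X Y|k _]; [rewrite finite_setU|exact: (hA k).1.1].
  move=> i Ai; have [k _ Aki] := bigsetU_bigcup Ai; exact: (hA k).1.2.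
exists (fun n => \big[setU/set0]_(k < n.+1) A k).
  split => // n m nm; exact: subset_bigsetU.
move=> n; apply: lt_le_trans (hA n).2 _; apply: finite_sqnorm_mono.
  exact: (fin n.+1).1.
by rewrite big_ord_recr; exact: subsetUr.
Qed.

Lemma L2_sum_exists : exists2 f, L2 f & L2_sum Lambda Phi z f.
Proof.
have [A_ [LA A_mono] QA] := exhausting_fsets.
pose g n := finite_sum z (A_ n).
have mg n : measurable_cfun (g n) by exact: measurable_finite_sum.
(* With [A] a later [A_ m] this is the Cauchy rate; with an arbitrary larger finite [A] it gives the
   convergence of the net in [L2_sum]. *)
have dist n A : fsets Lambda A -> A_ n `<=` A ->
    (\int[mu]_x (normc (finite_sum z A x - g n x) ^+ 2)%:E <= (B / 4 ^+ n)%:E)%E.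
  move=> LA' AA; apply: le_trans (finite_sum_dist z LA' (LA n) AA) _.
  rewrite lee_fin ler_pM2l// lerBlDr -lerBlDl.
  by apply: le_trans (ltW (QA n)); rewrite lerD2r finite_sqnorm_le.
have msq (f : Rspace R d -> R[i]) : measurable_cfun f ->
    measurable_fun setT (fun x => (normc (f x) ^+ 2)%:E).
  move=> mf; apply/measurable_EFinP; apply: measurable_funX.
  exact: measurable_normc.
have msqr (f : Rspace R d -> R) : measurable_fun setT f ->
    measurable_fun setT (fun x => (f x ^+ 2)%:E).
  by move=> mf; apply/measurable_EFinP; exact: measurable_funX.
pose gr n x := complex.Re (g n x); pose gi n x := complex.Im (g n x).
have mgr n : measurable_fun setT (gr n) by exact: (mg n).1.
have mgi n : measurable_fun setT (gi n) by exact: (mg n).2.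
have cr n m : (n <= m)%N ->
    (\int[mu]_x ((gr m x - gr n x) ^+ 2)%:E <= (B / 4 ^+ n)%:E)%E.
  move=> nm; apply: le_trans (dist n _ (LA m) (A_mono _ _ nm)).
  apply: ge0_le_integral => //.
  - by move=> x _; rewrite lee_fin sqr_ge0.
  - by apply: msqr; exact: measurable_funB.
  - by apply: (msq (fun x => g m x - g n x)); exact: measurable_cfunB.
  - by move=> x _; rewrite lee_fin sqr_normc -complex_ReB lerDl sqr_ge0.
have ci n m : (n <= m)%N ->
    (\int[mu]_x ((gi m x - gi n x) ^+ 2)%:E <= (B / 4 ^+ n)%:E)%E.
  move=> nm; apply: le_trans (dist n _ (LA m) (A_mono _ _ nm)).
  apply: ge0_le_integral => //.
  - by move=> x _; rewrite lee_fin sqr_ge0.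
  - by apply: msqr; exact: measurable_funB.
  - by apply: (msq (fun x => g m x - g n x)); exact: measurable_cfunB.
  - by move=> x _; rewrite lee_fin sqr_normc -complex_ImB lerDr sqr_ge0.
pose f x := (pointwise_limit gr x +i* pointwise_limit gi x)%C.
have mf : measurable_cfun f.
  by split; exact: measurable_pointwise_limit.
(* The real and imaginary parts converge separately, each at rate [B / 4 ^+ n], hence the factor
   2. *)
have fg n : (\int[mu]_x (normc (f x - g n x) ^+ 2)%:E <= (2 * B / 4 ^+ n)%:E)%E.
  have -> : (2 * B / 4 ^+ n)%:E = ((B / 4 ^+ n)%:E + (B / 4 ^+ n)%:E)%E.
    by rewrite -EFinD; congr EFin; ring.
  under eq_integral do rewrite sqr_normc complex_ReB complex_ImB EFinD.
  have m1 : measurable_fun setT (fun x => ((complex.Re (f x) - gr n x) ^+ 2)%:E).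
    by apply: (msqr (fun x => complex.Re (f x) - gr n x)); exact: measurable_funB mf.1 (mgr n).
  have m2 : measurable_fun setT (fun x => ((complex.Im (f x) - gi n x) ^+ 2)%:E).
    by apply: (msqr (fun x => complex.Im (f x) - gi n x)); exact: measurable_funB mf.2 (mgi n).
  rewrite ge0_integralD//; first last.
  - by move=> x _; rewrite lee_fin sqr_ge0.
  - by move=> x _; rewrite lee_fin sqr_ge0.
  by apply: leeD;
    [exact: (pointwise_limit_rate mgr cr)|exact: (pointwise_limit_rate mgi ci)].
have fgN n : (cLnorm 2%:E (fun x => f x - g n x)%R <= (Num.sqrt (2 * B) / 2 ^+ n)%:E)%E.
  apply: le_cLnorm2; first by rewrite divr_ge0 ?sqrtr_ge0 ?exprn_ge0.
  apply: le_trans (fg n) _; rewrite lee_fin exprMn sqr_sqrtr; last first.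
    by rewrite mulr_ge0// ltW.
  rewrite exprVn -exprM mulnC exprM.
  by rewrite (_ : 2 ^+ 2 = 4 :> R)//; ring.
exists f.
  split => //.
    move=> x k; rewrite /f /pointwise_limit /gr /gi /g.
    have gk n : finite_sum z (A_ n) (shift_int x k) = finite_sum z (A_ n) x.
      exact: periodic_finite_sum.
    by congr (fine (limn_esup _) +i* fine (limn_esup _))%C;
      apply/funext => n; rewrite gk.
  rewrite (_ : f = (fun x => (f x - g 0%N x) + g 0%N x)); last first.
    by apply/funext => x; rewrite subrK.
  apply: le_lt_trans (cLnorm2D (measurable_cfunB mf (mg 0%N)) (mg 0%N)) _.
  apply: lte_add_pinfty.
    by apply: le_lt_trans (fgN 0%N) _; rewrite ltry.
  have /andP[_] := finite_bounds z (LA 0%N); rewrite -/(g 0%N).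
  have := cLnorm_ge0 2%:E (g 0%N).
  by case: (cLnorm _ _) => [r| |]//; rewrite ltry.
move=> e e0.
(* One half of [e] pays for [f - g n], the other for [g n - finite_sum z A]. The index
   [N = Num.bound K] works because [K <= N <= 2 ^ N]. *)
have [n hn] : exists n, Num.sqrt (2 * B) / 2 ^+ n <= e / 2.
  have e20 : 0 < e / 2 by rewrite divr_gt0.
  pose K := Num.sqrt (2 * B) / (e / 2).
  have K0 : 0 <= K by rewrite divr_ge0 ?sqrtr_ge0 ?ltW.
  exists (Num.bound K); rewrite ler_pdivrMr ?exprn_gt0// [leRHS]mulrC -ler_pdivrMr//.
  apply: le_trans (ltW (archi_boundP K0)) _.
  by rewrite -natrX ler_nat ltnW// ltn_expl.
exists (A_ n) => // A LA' AA.
rewrite (_ : (fun x => _) = (fun x => (f x - g n x) + (g n x - finite_sum z A x)));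
  last first.
  by apply/funext => x; rewrite addrA subrK.
have mS := measurable_finite_sum z LA'.
apply: le_trans (cLnorm2D (measurable_cfunB mf (mg n)) (measurable_cfunB (mg n) mS)) _.
rewrite [e]splitr [leRHS]EFinD; apply: leeD.
  by apply: le_trans (fgN n) _; rewrite lee_fin.
apply: (@le_trans _ _ (Num.sqrt (2 * B) / 2 ^+ n)%:E); last by rewrite lee_fin.
apply: le_cLnorm2; first by rewrite divr_ge0 ?sqrtr_ge0 ?exprn_ge0.
under eq_integral do rewrite -normcN opprB.
apply: le_trans (dist n A LA' AA) _; rewrite lee_fin exprMn sqr_sqrtr; last first.
  by rewrite mulr_ge0// ltW.
rewrite exprVn -exprM mulnC exprM (_ : 2 ^+ 2 = 4 :> R); last by ring.
apply: ler_wpM2r; first by rewrite invr_ge0 exprn_ge0.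
by have := B_gt0; lra.
Qed.

(** The norm of [f] is within [e] of the norm [s] of some partial sum, whose square lies between
    [b * (Q - e)] and [B * Q]; then [e] tends to 0. *)
Lemma L2_sum_bounds f : L2 f -> L2_sum Lambda Phi z f ->
  (b%:E * ell2_sqnorm Lambda z <= cLnorm 2%:E f ^+ 2 <=
   B%:E * ell2_sqnorm Lambda z)%E.
Proof.
move=> [_ mf fN] fsum.
have [F FE] : exists F, cLnorm 2%:E f = F%:E.
  by exists (fine (cLnorm 2%:E f)); rewrite fineK// ge0_fin_numE// cLnorm_ge0.
have F0 : 0 <= F by rewrite -lee_fin -FE cLnorm_ge0.
have Q0 : 0 <= Q by rewrite -lee_fin -QE; apply: esum_ge0 => i _; rewrite lee_fin sqr_ge0.
have key (e : R) : 0 < e -> exists s : R,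
    [/\ 0 <= s, F <= e + s, s <= e + F, s ^+ 2 <= B * Q & b * (Q - e) <= s ^+ 2].
  move=> e0; have [A0 LA0 hA0] := fsum e e0.
  have [A1 LA1 hA1] := finite_sqnorm_approx e0.
  (* [A0] makes the partial sum close to [f], [A1] makes the coefficient norm close to [Q]; both
     properties persist on larger finite sets. *)
  pose A := A0 `|` A1.
  have LA : fsets Lambda A.
    split; first by rewrite finite_setU; split; [exact: LA0.1|exact: LA1.1].
    by move=> i [] ?; [exact: LA0.2|exact: LA1.2].
  have hA := hA0 A LA (@subsetUl _ _ _).
  have qA := finite_sqnorm_le LA.
  have qA1 : Q - e <= finite_sqnorm z A.
    by apply: le_trans (ltW hA1) _; apply: finite_sqnorm_mono; [exact: LA.1|exact: subsetUr].
  have mS := measurable_finite_sum z LA.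
  have := finite_bounds z LA; have := cLnorm_ge0 2%:E (finite_sum z A).
  have N1 : (cLnorm 2%:E f <= cLnorm 2%:E (fun x => f x - finite_sum z A x)%R +
      cLnorm 2%:E (finite_sum z A))%E.
    rewrite [in leLHS](_ : f = (fun x => (f x - finite_sum z A x) + finite_sum z A x)).
      exact: cLnorm2D (measurable_cfunB mf mS) mS.
    by apply/funext => x; rewrite subrK.
  have N2 : (cLnorm 2%:E (finite_sum z A) <=
      cLnorm 2%:E (fun x => f x - finite_sum z A x)%R + cLnorm 2%:E f)%E.
    rewrite [in leLHS](_ : finite_sum z A = (fun x => (finite_sum z A x - f x) + f x)).
      apply: le_trans (cLnorm2D (measurable_cfunB mS mf) mf) _.
      by rewrite -cLnormN; under eq_fun do rewrite opprB.
    by apply/funext => x; rewrite subrK.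
  have {}N2 : (cLnorm 2%:E (finite_sum z A) <= (e + F)%:E)%E.
    by apply: le_trans N2 _; rewrite [leRHS]EFinD FE leeD2r.
  move: N1 N2; rewrite FE; case: (cLnorm 2%:E (finite_sum z A)) => [s| |]//.
  move=> N1 N2; rewrite lee_fin => s0; rewrite -EFin_expe !lee_fin => /andP[bs sB].
  exists s; split => //.
  - by rewrite -lee_fin [leRHS]EFinD; apply: le_trans N1 _; rewrite leeD2r.
  - by apply: le_trans sB _; rewrite ler_pM2l.
  - by apply: le_trans bs; rewrite ler_pM2l.
rewrite FE QE -EFin_expe -!EFinM !lee_fin; apply/andP; split.
  apply/ler_addgt0Pr => e e0.
  (* For [t <= 1], [b * (Q - t) <= (t + F) ^+ 2] gives [b * Q <= F ^+ 2 + t * (b + 2 * F + 1)],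
     using [t ^+ 2 <= t]; the choice of [t] makes the error at most [e]. *)
  pose K := b + 2 * F + 1.
  have K0 : 0 < K by rewrite /K; have := b_gt0; lra.
  pose t := Num.min 1 (e / K).
  have t0 : 0 < t by rewrite lt_min ltr01 divr_gt0.
  have t1 : t <= 1 by rewrite ge_min lexx.
  have tK : t * K <= e by rewrite -ler_pdivlMr// ge_min lexx orbT.
  have [s [s0 _ sF _ sb]] := key t t0.
  have : s ^+ 2 <= (t + F) ^+ 2 by rewrite ler_sqr ?nnegrE ?addr_ge0// ltW.
  have tt : t ^+ 2 <= t by rewrite expr2 ler_piMr// ltW.
  rewrite /K in tK; rewrite sqrrD; lra.
have BQ0 : 0 <= B * Q by rewrite mulr_ge0// ltW.
rewrite -(sqr_sqrtr BQ0) ler_sqr ?nnegrE ?sqrtr_ge0//.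
apply/ler_addgt0Pl => e e0.
have [s [s0 Fs _ sB _]] := key e e0.
apply: le_trans Fs _; rewrite lerD2l.
by rewrite -(ger0_norm s0) -sqrtr_sqr ler_wsqrtr.
Qed.

End fixed_coefficients.

Lemma riesz_system_of_finite_bounds : riesz_system Lambda Phi b B.
Proof.
split => //; first exact: L2_Phi.
move=> z z2; split; first exact: L2_sum_exists.
exact: L2_sum_bounds.
Qed.

End riesz_system_from_finite_sums.

(** * The diffusion system *)

Section diffusion_system.
Variables (R : realType) (d : nat) (l : 'rV[int]_d) (e0 es : R[i]).
Local Notation Phi nu :=
  (diffusion (fun x => e0 + es * fourier l x) (@Psi R d nu)).

Let alpha : R := normc es * (2 * norm2 R l + 3).

Let diffusion_PsiE nu : nu != 0 -> Phi nu = (fun x =>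
  e0 * fourier nu x + es * (coupling R nu l)%:C%C * fourier (nu + l) x).
Proof. by move=> nu0; apply/funext => x; exact: diffusion_Psi. Qed.

Lemma periodic_diffusion_Psi nu : nu != 0 -> Defs.periodic (Phi nu).
Proof.
by move=> nu0; rewrite diffusion_PsiE// => x k; rewrite !fourier_periodic.
Qed.

Lemma measurable_diffusion_Psi nu : nu != 0 -> measurable_cfun (Phi nu).
Proof.
move=> nu0; rewrite diffusion_PsiE//.
by apply: measurable_cfunD; apply: measurable_cfunZ; exact: measurable_fourier.
Qed.

Lemma coupling_le nu : nu != 0 ->
  normc es * `|coupling R nu l| <= alpha / 2.
Proof.
move=> nu0.
apply: (@le_trans _ _ (normc es * (1 + norm2 R l))).
  by rewrite ler_wpM2l ?normc_ge0// normr_coupling.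
by rewrite /alpha; have := normc_ge0 es; lra.
Qed.

Lemma normc_diffusion_Psi nu x : nu != 0 ->
  normc (Phi nu x) <= normc e0 + alpha / 2.
Proof.
move=> nu0; rewrite diffusion_PsiE//; apply: le_trans (le_normcD _ _) _.
rewrite !normcM !normc_fourier !mulr1 normc_real.
by rewrite lerD2l coupling_le.
Qed.

Lemma diffusion_finite_bounds (Lambda : set 'rV[int]_d) :
  alpha < normc e0 -> ~ Lambda 0 -> forall z A, fsets Lambda A ->
  (((normc e0 ^+ 2 - normc e0 * alpha) * finite_sqnorm z A)%:E <=
   cLnorm 2%:E (finite_sum (fun nu => Phi nu) z A) ^+ 2 <=
   ((normc e0 + alpha / 2) ^+ 2 * finite_sqnorm z A)%:E)%E.
Proof.
move=> alpha_e0 L0 z A [fA AL].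
have A0 nu : A nu -> nu != 0.
  by move=> /AL Lnu; apply/eqP => nu0; apply: L0; rewrite -nu0.
pose s : seq 'rV[int]_d := finmap.enum_fset (fset_set A).
have us : uniq s by exact: finmap.fset_uniq.
have sA nu : nu \in s -> nu != 0 by rewrite in_fset_set// inE => /A0.
pose q := finite_sqnorm z A.
have qE : q = \sum_(i <- s) normc (z i) ^+ 2 by rewrite /q /finite_sqnorm fsbig_finite.
have q0 : 0 <= q by exact: finite_sqnorm_ge0.
pose U x := \sum_(i <- s) z i * fourier i x.
pose V x := \sum_(i <- s) (z i * (es * (coupling R i l)%:C%C)) * fourier (i + l) x.
have mU : measurable_cfun U.
  by apply: measurable_cfun_sum => i _; apply: measurable_cfunZ; exact: measurable_fourier.
have mV : measurable_cfun V.
  by apply: measurable_cfun_sum => i _; apply: measurable_cfunZ; exact: measurable_fourier.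
have SE : finite_sum (fun nu => Phi nu) z A = (fun x => e0 * U x + V x).
  apply/funext => x; rewrite /finite_sum fsbig_finite// mulr_sumr -big_split/=.
  by apply: eq_big_seq => i /sA i0; rewrite diffusion_PsiE//; ring.
have UE : cLnorm 2%:E U = (Num.sqrt q)%:E.
  by rewrite qE (cLnorm2_trig_poly z (g := id)).
have [v [v0 vq VE]] : exists v : R,
    [/\ 0 <= v, v <= alpha / 2 * Num.sqrt q & cLnorm 2%:E V = v%:E].
  have addl_inj : injective (fun i : 'rV[int]_d => i + l) by exact: addIr.
  exists (Num.sqrt (\sum_(i <- s) normc (z i * (es * (coupling R i l)%:C%C)) ^+ 2)).
  split; [exact: sqrtr_ge0| |exact: cLnorm2_trig_poly].
  have alpha0 : 0 <= alpha / 2.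
    by rewrite divr_ge0// mulr_ge0 ?normc_ge0// addr_ge0// mulr_ge0// sqrtr_ge0.
  (* The factor [alpha / 2] goes under the root, so that the two sums are compared term by term with
     [coupling_le]. *)
  rewrite -[alpha / 2]ger0_norm// -sqrtr_sqr -sqrtrM ?sqr_ge0// ler_wsqrtr//.
  rewrite qE mulr_sumr big_seq [leRHS]big_seq; apply: ler_sum => i /sA i0.
  rewrite !normcM normc_real exprMn mulrC ler_wpM2r ?sqr_ge0//.
  rewrite ler_sqr ?nnegrE//; first exact: coupling_le.
  by rewrite mulr_ge0 ?normc_ge0.
have meU := measurable_cfunZ e0 mU.
have up := cLnorm2D meU mV; rewrite -SE cLnorm2Z// UE VE -EFinM -EFinD in up.
have low : (cLnorm 2%:E (fun x => e0 * U x)%R <=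
    cLnorm 2%:E (finite_sum (fun nu => Phi nu) z A) + cLnorm 2%:E V)%E.
  rewrite [in leLHS](_ : (fun x => e0 * U x) =
      (fun x => finite_sum (fun nu => Phi nu) z A x + - V x)).
    have mS : measurable_cfun (finite_sum (fun nu => Phi nu) z A).
      by rewrite SE; exact: measurable_cfunD.
    have mNV : measurable_cfun (fun x => - V x).
      by under eq_fun do rewrite -mulN1r; exact: measurable_cfunZ.
    by apply: le_trans (cLnorm2D mS mNV) _; rewrite cLnormN.
  by apply/funext => x; rewrite SE addrK.
rewrite cLnorm2Z// UE VE -EFinM in low.
move: up low (cLnorm_ge0 2%:E (finite_sum (fun nu => Phi nu) z A)).
case: (cLnorm _ _) => [t| |]//; rewrite -!EFinD !lee_fin => up low t0.
rewrite -expr2 -/q -{1 2}(sqr_sqrtr q0).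
have r0 := sqrtr_ge0 q; set r := Num.sqrt q in up low vq r0 *.
have e00 := normc_ge0 e0.
apply/andP; split.
  (* Squaring the lower bound for [t] requires [alpha / 2 <= |e0|], which follows from
     [0 <= alpha < |e0|]. The square contains the extra nonnegative term [(alpha * r) ^+ 2 / 4],
     which is dropped to reach the stated constant. *)
  have e0r : 0 <= (normc e0 - alpha / 2) * r.
    apply: mulr_ge0 => //.
    have : 0 <= alpha.
      by rewrite mulr_ge0 ?normc_ge0// addr_ge0// mulr_ge0// sqrtr_ge0.
    lra.
  have rt : (normc e0 - alpha / 2) * r <= t by lra.
  have : ((normc e0 - alpha / 2) * r) ^+ 2 <= t ^+ 2 by rewrite ler_sqr.
  rewrite exprMn; have : 0 <= (alpha * r) ^+ 2 by exact: sqr_ge0.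
  rewrite exprMn; nra.
have tr : t <= (normc e0 + alpha / 2) * r by lra.
by rewrite -exprMn ler_sqr ?nnegrE//; exact: le_trans tr.
Qed.

End diffusion_system.

Theorem proposition1 (R : realType) (d : nat) (d_gt0 : (0 < d)%N)
    (nus : 'rV[int]_d) (e0 es : R[i]) :
  let a := fun x => e0 + es * fourier nus x in
  let alpha := normc es * (2 * norm2 R nus + 3) in
  alpha < normc e0 ->
  forall Lambda : set 'rV[int]_d, ~ Lambda 0 ->
  bounded_riesz_system Lambda (fun nu => diffusion a (@Psi R d nu))
    (normc e0 ^+ 2 - normc e0 * alpha)
    ((normc e0 + alpha / 2) ^+ 2)
    (normc e0 + alpha / 2).
Proof.
move=> a alpha alpha_e0 Lambda L0.
have alpha0 : 0 <= alpha.
  by rewrite mulr_ge0 ?normc_ge0// addr_ge0// mulr_ge0// sqrtr_ge0.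
have Lneq0 nu : Lambda nu -> nu != 0.
  by move=> Lnu; apply/eqP => nu0; apply: L0; rewrite -nu0.
have e0_gt0 : 0 < normc e0 by exact: le_lt_trans alpha_e0.
split.
- apply: riesz_system_of_finite_bounds.
  + by rewrite expr2 -mulrBr mulr_gt0// subr_gt0.
  + by rewrite sqrrD; nra.
  + by move=> nu /Lneq0; exact: periodic_diffusion_Psi.
  + by move=> nu /Lneq0; exact: measurable_diffusion_Psi.
  + exact: diffusion_finite_bounds.
- by rewrite ltr_pwDl// divr_ge0.
(* At exponent [+oo], [Lnorm] is the essential supremum when the whole space has positive measure
   and 0 otherwise; the pointwise bound settles the first case, [0 <= K] the second. *)
move=> nu /Lneq0 nu0; rewrite /cLnorm unlock; case: ifPn => _.
  apply/ess_supP; apply: nearW => x /=.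
  rewrite lee_fin ger0_norm ?normc_ge0//; exact: normc_diffusion_Psi.
by rewrite lee_fin addr_ge0 ?normc_ge0// divr_ge0.
Qed.
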